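(* Let $a,b\in\mathbb{Z}_{\ge 0}$ and let $\{A_N(q)\}_{N\ge 0}$, $\{B_N(M,q)\}$ be sequences forming a Burge pair, i.e. $$B_N(M,q)=\sum_{j\ge 0}A_j(q)\,Q(N,M,aj,bj,q)\qquad\text{for all } N,M\in\mathbb{Z}_{\ge 0}.$$ Then for all $N,M\in\mathbb{Z}_{\ge 0}$, $$\sum_{i\ge 0} q^{(1+2M)i}\begin{bmatrix}2M+N-i\\ N-i\end{bmatrix}_q B_i(-1-M,q)=\sum_{j\ge 0}A_j(q)\,q^{2aj^2(a-b)}\,Q(N,M,aj,(2a-b)j,q),$$ where $B_i(-1-M,q)$ denotes $\sum_{j\ge0}A_j(q)\,Q(i,-1-M,aj,bj,q)$ (the defining formula evaluated at the negative integer $-1-M$, using the $q$-binomial convention below).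
   Context: $(x;q)_n=(1-x)(1-xq)\cdots(1-xq^{n-1})$ for $n>0$, $(x;q)_0=1$, and $(x)_n=(x;q)_n$. For integers $N$ and $j$, the $q$-binomial coefficient is $\begin{bmatrix}N\\ j\end{bmatrix}_q=\frac{(q^{N-j+1})_j}{(q)_j}$ if $j\ge 0$ and $0$ otherwise (this formula is used also when $N$ is negative). For integers $N,M,c,d$, $Q(N,M,c,d,q)=\begin{bmatrix}N+M+c-d\\ N+c\end{bmatrix}_q\begin{bmatrix}N+M-c+d\\ N-c\end{bmatrix}_q$. *)

(* Defs.v *)
From HB Require Import structures.
From mathcomp Require Import all_boot all_order all_algebra.
From mathcomp Require Import all_classical all_reals all_analysis.

Set Implicit Arguments.
Unset Strict Implicit.
Unset Printing Implicit Defensive.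

Import Order.TTheory GRing.Theory Num.Theory.

Local Open Scope classical_set_scope.
Local Open Scope ring_scope.

(* Topological fields: the scalars may be a field with the discrete topology,
   the real or complex numbers, or formal Laurent series in q with the q-adic
   topology. When 0 < a every sum over j below is finite and the topology plays
   no role; it gives a meaning to the infinite sums that occur when a = 0. *)
HB.mixin Record isTopologicalField K & GRing.Field K & Topological K := {
  mulr_continuous : continuous (fun x : K * K => x.1 * x.2) ;
  invr_continuous : forall x : K, x != 0 -> {for x, continuous (@GRing.inv K)}
}.

#[short(type="topologicalFieldType")]
HB.structure Definition TopologicalField :=
  {K of GRing.Field K & TopologicalZmodule K & isTopologicalField K}.

Section Definitions.
Variable K : topologicalFieldType.
Implicit Types (q x : K) (N M c d j : int).

Definition sums_to (u : nat -> K) (l : K) : Prop := series u @ \oo --> l.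

Definition has_infsum (u : nat -> K) : Prop := exists l, sums_to u l.

(* Junk value 0 if u has no sum; the sum is unique when K is Hausdorff. *)
Definition infsum (u : nat -> K) : K := xget 0 (sums_to u).

Definition qpoch x q (n : nat) : K := \prod_(k < n) (1 - x * q ^+ k).

Definition qbinom q N j : K :=
  if 0 <= j then qpoch (q ^ (N - j + 1)) q `|j|%N / qpoch q q `|j|%N else 0.

Definition burgeQ N M c d q : K :=
  qbinom q (N + M + c - d) (N + c) * qbinom q (N + M - c + d) (N - c).

Definition burge_term (a b : nat) q (A : nat -> K) N M (j : nat) : K :=
  A j * burgeQ N M (a%:Z * j%:Z) (b%:Z * j%:Z) q.

Definition burge_pair (a b : nat) q (A : nat -> K) (B : nat -> int -> K) :
    Prop :=
  forall N M : nat, has_infsum (burge_term a b q A N%:Z M%:Z) /\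
    B N M%:Z = infsum (burge_term a b q A N%:Z M%:Z).

End Definitions.

(* Main.v *)
Require Import Defs.
From HB Require Import structures.
From mathcomp Require Import all_boot all_order all_algebra.
From mathcomp Require Import all_classical all_reals all_analysis.
From mathcomp Require Import ring zify.

(* With [c = a j] and [d = b j], the coefficient of [A j] on both sides gives a
   finite identity which, once [x = q ^ (- M - d)], [y = q ^ (d - M)] and
   [U = q ^ (2 M + 1)] (so that [x y U = q]) are substituted, is the
   q-Pfaff-Saalschuetz sum; the latter follows from a first-order recurrence in
   [N] with a telescoping certificate. Summing over [j] only uses linearity of
   convergent series. Convergence at [-1 - M] matters only for [a = 0]: then
   [Q(i, M, 0, d)] is a polynomial of degree [i] in [q ^ d + q ^ (- d)] for
   every [M], hence a combination of the [Q(k, 0, 0, d)] with [k <= i]. *)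

Set Implicit Arguments.
Unset Strict Implicit.
Unset Printing Implicit Defensive.

Import Order.TTheory GRing.Theory Num.Theory.

Local Open Scope classical_set_scope.
Local Open Scope ring_scope.

(** * Linear combinations of convergent series *)

Section InfiniteSums.
Variable K : topologicalFieldType.
Implicit Types (u v : nat -> K) (l c : K).

Lemma sums_toD u v l m :
  sums_to u l -> sums_to v m -> sums_to (fun j => u j + v j) (l + m).
Proof.
move=> ul vm; rewrite /sums_to.
have -> : series (fun j => u j + v j) = (fun n => series u n + series v n).
  by apply/funext => n; rewrite /series /= big_split.
apply: (@continuous2_cvg _ _ _ _ _ _ _ _ (fun x y : K => x + y)) => //.
exact: (@add_continuous K (l, m)).
Qed.

Lemma sums_toZ c u l : sums_to u l -> sums_to (fun j => c * u j) (c * l).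
Proof.
move=> ul; rewrite /sums_to.
have -> : series (fun j => c * u j) = (fun n => c * series u n).
  by apply/funext => n; rewrite /series /= mulr_sumr.
apply: (@continuous2_cvg _ _ _ _ _ _ _ _ (fun x y : K => x * y)) => //; last exact: cvg_cst.
exact: (@mulr_continuous K (c, l)).
Qed.

Lemma sums_to_finite u (n : nat) :
  (forall j, (n <= j)%N -> u j = 0) -> sums_to u (\sum_(j < n) u j).
Proof.
move=> u0; apply: cvg_near_cst; exists n => // m /= nm.
rewrite /series /= -(big_mkord xpredT) (big_cat_nat (n := n)) //=.
rewrite [X in _ + X]big_nat_cond [X in _ + X]big1 ?addr0 // => i.
by rewrite andbT => /andP[/u0].
Qed.

Lemma sums_to_sum (n : nat) (c : nat -> K) (u : nat -> nat -> K) (l : nat -> K) :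
  (forall i, sums_to (u i) (l i)) ->
  sums_to (fun j => \sum_(i < n) c i * u i j) (\sum_(i < n) c i * l i).
Proof.
move=> ul; elim: n => [|n IH].
  have := @sums_to_finite (fun=> 0) 0%N (fun _ _ => erefl).
  by congr sums_to; [apply/funext => j|]; rewrite !big_ord0.
have := sums_toD IH (sums_toZ (c := c n) (ul n)).
by congr sums_to; [apply/funext => j|]; rewrite big_ord_recr.
Qed.

Lemma has_infsumP u : has_infsum u -> sums_to u (infsum u).
Proof. exact: xgetPex. Qed.

Lemma infsum_eq (hK : hausdorff_space K) u l : sums_to u l -> infsum u = l.
Proof.
by move=> ul; apply: (cvg_unique hK (has_infsumP _) ul); exists l.
Qed.

(* Multiplication by [y] maps [p k] into the span of [p k.+1] and [p k], so the
   class of [f] for which all series [A * p k * f] converge is stable under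
   multiplication by affine functions of [y]. *)
Lemma has_infsum_affine_prod (A y : nat -> K) (p : nat -> nat -> K)
    (r s r' s' : nat -> K) (n : nat) :
  (forall k, s k != 0) ->
  (forall j, p 0%N j = 1) ->
  (forall k j, p k.+1 j = p k j * (r k + s k * y j)) ->
  (forall k, has_infsum (fun j => A j * p k j)) ->
  has_infsum (fun j => A j * \prod_(i < n) (r' i + s' i * y j)).
Proof.
move=> s0 p0 pS Ap.
suff H k : has_infsum (fun j => A j * p k j * \prod_(i < n) (r' i + s' i * y j)).
  by have := H 0%N; congr has_infsum; apply/funext => j; rewrite p0 mulr1.
elim: n k => [|n IH] k.
  have := Ap k; congr has_infsum.
  by apply/funext => j; rewrite big_ord0 mulr1.
have [l1 h1] := IH k; have [l2 h2] := IH k.+1.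
(* The coefficients come from [p k * y = (p k.+1 - r k * p k) / s k]. *)
eexists; have := sums_toD (sums_toZ (c := r' n - s' n * (r k / s k)) h1)
  (sums_toZ (c := s' n / s k) h2).
congr sums_to; apply/funext => j; rewrite big_ord_recr /= pS.
by field.
Qed.

End InfiniteSums.

(** * q-Pochhammer symbols and the q-Pfaff-Saalschuetz sum *)

Section QSeries.
Variables (K : topologicalFieldType) (q : K).
Hypothesis hq0 : q != 0.
Hypothesis hq : forall n : nat, (0 < n)%N -> q ^+ n != 1.

Lemma qpoch0 (x : K) : qpoch x q 0 = 1.
Proof. by rewrite /qpoch big_ord0. Qed.

Lemma qpochS (x : K) n : qpoch x q n.+1 = qpoch x q n * (1 - x * q ^+ n).
Proof. by rewrite /qpoch big_ord_recr. Qed.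

Lemma qpochD (x : K) m n :
  qpoch x q (m + n) = qpoch x q m * qpoch (x * q ^+ m) q n.
Proof.
elim: n => [|n IH]; first by rewrite addn0 qpoch0 mulr1.
by rewrite addnS !qpochS IH exprD !mulrA.
Qed.

Lemma subr_qX_neq0 n : (0 < n)%N -> 1 - q ^+ n != 0.
Proof. by move=> /hq; rewrite subr_eq0 eq_sym. Qed.

Lemma qpoch_qq_neq0 n : qpoch q q n != 0.
Proof.
elim: n => [|n IH]; first by rewrite qpoch0 oner_neq0.
by rewrite qpochS mulf_neq0 // -exprS subr_qX_neq0.
Qed.

(** Since [z = q ^ (1 - n) / x], the factor [1 - x * q ^+ k] equals [- x * q ^+ k] times the factor
    of index [n - 1 - k] in [qpoch z q n]. *)
Lemma qpoch_rev (x z : K) n :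
  z * x * q ^+ n = q -> qpoch x q n = (- x) ^+ n * q ^+ 'C(n, 2) * qpoch z q n.
Proof.
move=> zx; rewrite /qpoch [in RHS](reindex_inj rev_ord_inj) /=.
have -> : (- x) ^+ n = \prod_(k < n) (- x) by rewrite prodr_const card_ord.
rewrite -bin2_sum expr_sum big_mkord -!big_split /=; apply: eq_bigr => k _.
have zx1 : z * x * q ^+ (n - k.+1) * q ^+ k = 1.
  apply: (mulIf hq0); rewrite mul1r -[RHS]zx -!mulrA -exprSr -exprD.
  by congr (_ * (_ * _ ^+ _)); have := ltn_ord k; lia.
by rewrite -[X in X - _ = _]zx1; ring.
Qed.

(* The q-Zeilberger certificate of the q-Pfaff-Saalschuetz sum is
   [q ^+ (n.+1 - k) * (1 - q ^+ k) * (1 - q ^+ (s + k))]. *)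
Lemma qsaalschutz (x y U : K) s n :
  x * y * U = q ->
  \sum_(k < n.+1) U ^+ k * (qpoch U q (n - k) / qpoch q q (n - k))
    * (qpoch x q (s + k) / qpoch q q (s + k)) * (qpoch y q k / qpoch q q k)
  = qpoch x q s * qpoch (x * U * q ^+ s) q n / qpoch q q (s + n)
    * (qpoch (y * U) q n / qpoch q q n).
Proof.
move=> xyU.
pose T m k := U ^+ k * (qpoch U q m / qpoch q q m)
    * (qpoch x q (s + k) / qpoch q q (s + k)) * (qpoch y q k / qpoch q q k).
pose P m := (1 - q ^+ (s + m).+1) * (1 - q ^+ m.+1).
pose R m := (1 - x * U * q ^+ s * q ^+ m) * (1 - y * U * q ^+ m).
(* The certificate identity for upper limit [k + m]: taking [m = n - k] as an independent variable
   avoids truncated subtraction. *)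
have step m k : P (k + m)%N * T m.+1 k - R (k + m)%N * T m k =
    q ^+ m.+1 * (1 - q ^+ k) * (1 - q ^+ (s + k)) * T m.+1 k
    - q ^+ m * (1 - q ^+ k.+1) * (1 - q ^+ (s + k.+1)) * T m k.+1.
  have Z0 := subr_qX_neq0 (ltn0Sn m).
  have Q0 := subr_qX_neq0 (ltn0Sn k).
  have S0 := subr_qX_neq0 (ltn0Sn (s + k)).
  have T1 : T m.+1 k = T m k * ((1 - U * q ^+ m) / (1 - q ^+ m.+1)).
    rewrite /T !qpochS -!exprS; field.
    by rewrite Z0 !qpoch_qq_neq0.
  have T2 : (1 - q ^+ k.+1) * (1 - q ^+ (s + k.+1)) * T m k.+1 =
      T m k * U * (1 - x * q ^+ (s + k)) * (1 - y * q ^+ k).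
    rewrite /T addnS !qpochS -!exprS [U ^+ k.+1]exprS.
    move: (q ^+ k.+1) (q ^+ (s + k).+1) Q0 S0 => Q S Q0 S0; field.
    by rewrite Q0 S0 !qpoch_qq_neq0.
  rewrite -[X in _ = _ - X]mulrA -[X in _ = _ - X]mulrA.
  rewrite [X in _ = _ - _ * X]mulrA T2 T1.
  move: Z0; rewrite /P /R !(exprS, exprD).
  move: (T m k) (q ^+ k) (q ^+ m) (q ^+ s) => t Q Z S.
  by rewrite -xyU => Z0; field.
(* Telescoping: the lower boundary term vanishes because of the factor [1 - q ^+ k] at [k = 0]. *)
have part m n' : (m <= n'.+1)%N ->
    \sum_(k < m) (P n' * T (n'.+1 - k)%N k - R n' * T (n' - k)%N k)
    = - (q ^+ (n'.+1 - m) * (1 - q ^+ m) * (1 - q ^+ (s + m))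
         * T (n'.+1 - m)%N m).
  elim: m => [|m IH] mn; first by rewrite big_ord0 expr0 subrr mulr0 !mul0r oppr0.
  rewrite big_ord_recr /= IH 1?ltnW // subSS subSn //.
  have := step (n' - m)%N m; rewrite subnKC // => ->.
  by ring.
(* The upper boundary term is [- P n' * T 0 n'.+1], which cancels the last summand on the left, the
   one that the telescoped range omits. *)
have rec n' : P n' * \sum_(k < n'.+2) T (n'.+1 - k)%N k
    = R n' * \sum_(k < n'.+1) T (n' - k)%N k.
  have := part n'.+1 n' (leqnn _); rewrite subnn big_split /= sumrN -!mulr_sumr.
  move=> e; rewrite big_ord_recr /= subnn mulrDr.
  move/eqP: e; rewrite subr_eq => /eqP ->.
  by rewrite /P addnS expr0; ring.
rewrite -[LHS]/(\sum_(k < n.+1) T (n - k)%N k).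
elim: n => [|n IH].
  by rewrite big_ord1 /T addn0 !qpoch0 expr0 divr1 !mul1r !mulr1.
have P0 : P n != 0 by rewrite mulf_neq0 ?subr_qX_neq0.
apply: (mulfI P0); rewrite rec IH /P /R addnS !qpochS -!exprS; field.
by rewrite !subr_qX_neq0 // !qpoch_qq_neq0.
Qed.

(** * The identity for a single coefficient [A j] *)

Lemma qbinom_nat (n : int) (k : nat) :
  qbinom q n k = qpoch (q ^ (n - k%:Z + 1)) q k / qpoch q q k.
Proof. by []. Qed.

Lemma qbinom_neg (n k : int) : k < 0 -> qbinom q n k = 0.
Proof. by rewrite /qbinom leNgt => ->. Qed.

Lemma burgeQ_lt (i c : nat) (M d : int) :
  (i < c)%N -> burgeQ i%:Z M c%:Z d q = 0.
Proof.
by move=> ic; rewrite /burgeQ [X in _ * X]qbinom_neg ?mulr0 // subr_lt0 ltz_nat.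
Qed.

Lemma burge_sum (N M c : nat) (d : int) :
  \sum_(i < N.+1) q ^ ((1 + 2 * M%:Z) * i%:Z)
      * qbinom q (2 * M%:Z + N%:Z - i%:Z) (N%:Z - i%:Z)
      * burgeQ i%:Z (-1 - M%:Z) c%:Z d q
  = q ^ (2 * c%:Z * (c%:Z - d)) * burgeQ N%:Z M%:Z c%:Z (2 * c%:Z - d) q.
Proof.
have [Nc|] := ltnP N c.
  rewrite burgeQ_lt // mulr0 big1 // => i _.
  by rewrite burgeQ_lt ?mulr0 // (leq_trans (ltn_ord i)).
move/subnKC; move: (N - c)%N => n <- {N}.
rewrite -(big_mkord xpredT (fun i : nat => q ^ ((1 + 2 * M%:Z) * i%:Z)
      * qbinom q (2 * M%:Z + (c + n)%:Z - i%:Z) ((c + n)%:Z - i%:Z)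
      * burgeQ i%:Z (-1 - M%:Z) c%:Z d q)).
rewrite (big_cat_nat (n := c)) ?leqW ?leq_addr //=.
rewrite big_nat_cond big1 ?add0r; last first.
  by move=> i; rewrite andbT => /andP[_ ic]; rewrite burgeQ_lt ?mulr0.
rewrite -{1}[c]add0n big_addn subSn ?leq_addr // addKn big_mkord.
pose x := q ^ (- M%:Z - d); pose y := q ^ (d - M%:Z).
pose U := q ^+ (2 * M + 1).
have xyU : x * y * U = q.
  rewrite /x /y /U exprnP -!expfzDr // -[RHS]expr1z; congr (_ ^ _); lia.
(* Terms with [i < c] are gone and [n] stands for [N - c]; the shift [i = k + c] accounts for
   [s = 2 * c] and for the extra factor [U ^+ c]. *)
have := @qsaalschutz x y U (2 * c) n xyU.
move/(congr1 (fun z => U ^+ c * z)); rewrite mulr_sumr.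
have <- : \sum_(i < n.+1) q ^ ((1 + 2 * M%:Z) * (i + c)%:Z)
      * qbinom q (2 * M%:Z + (c + n)%:Z - (i + c)%:Z) ((c + n)%:Z - (i + c)%:Z)
      * burgeQ (i + c)%:Z (-1 - M%:Z) c%:Z d q =
   \sum_(k < n.+1) U ^+ c * (U ^+ k * (qpoch U q (n - k) / qpoch q q (n - k))
    * (qpoch x q (2 * c + k) / qpoch q q (2 * c + k))
    * (qpoch y q k / qpoch q q k)).
  apply: eq_bigr => -[k /= kn] _; rewrite ltnS in kn.
  have -> : (c + n)%:Z - (k + c)%:Z = (n - k)%N by lia.
  rewrite /burgeQ.
  have -> : (k + c)%:Z - c%:Z = k by lia.
  have -> : (k + c)%:Z + c%:Z = (2 * c + k)%N by lia.
  rewrite !qbinom_nat.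
  have -> : q ^ ((1 + 2 * M%:Z) * (k + c)%:Z) = U ^+ c * U ^+ k.
    rewrite /U -exprD -exprM exprnP; congr (_ ^ _); lia.
  have -> : q ^ (2 * M%:Z + (c + n)%:Z - (k + c)%:Z - (n - k)%N%:Z + 1) = U.
    rewrite /U exprnP; congr (_ ^ _); lia.
  have -> : q ^ ((k + c)%:Z + (-1 - M%:Z) + c%:Z - d - (2 * c + k)%N%:Z + 1) = x.
    rewrite /x; congr (_ ^ _); lia.
  have -> : q ^ ((k + c)%:Z + (-1 - M%:Z) - c%:Z + d - k%:Z + 1) = y.
    rewrite /y; congr (_ ^ _); lia.
  by rewrite !mulrA.
move=> ->; rewrite /burgeQ.
have -> : (c + n)%:Z - c%:Z = n by lia.
have -> : (c + n)%:Z + c%:Z = (2 * c + n)%N by lia.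
rewrite !qbinom_nat.
set z := q ^ (_ - (2 * c + n)%N%:Z + 1).
have -> : q ^ ((c + n)%:Z + M%:Z - c%:Z + (2 * c%:Z - d) - n%:Z + 1)
    = x * U * q ^+ (2 * c).
  rewrite /x /U !exprnP -!expfzDr //; congr (_ ^ _); lia.
have zU : z * q ^+ (2 * c) = y * U.
  rewrite /z /y /U !exprnP -!expfzDr //; congr (_ ^ _); lia.
(* Of the [2 * c + n] factors, the last [n] form [qpoch (y * U) q n]; the first [2 * c] are matched
   with [qpoch x q (2 * c)] by reversal, which produces the power of [q]. *)
rewrite [qpoch z _ _]qpochD zU.
have zx : z * x * q ^+ (2 * c) = q by rewrite mulrAC zU mulrAC [y * x]mulrC.
rewrite (qpoch_rev zx).
(* The sign is even, and the exponents add up as [c (2 M + 1) - 2 c (M + d) + c (2 c - 1) = 2 c (c -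
   d)]. *)
have <- : U ^+ c * ((- x) ^+ (2 * c) * q ^+ 'C(2 * c, 2)) =
   q ^ (2 * c%:Z * (c%:Z - d)).
  have -> : 'C(2 * c, 2) = (c * (2 * c - 1))%N.
    rewrite bin2 -mulnA mul2n doubleK; congr (_ * _)%N; lia.
  rewrite exprM sqrrN -exprM /U /x -exprM !exprnP exprz_exp -!expfzDr //.
  by congr (_ ^ _); case: c {zU zx z} => [|c]; nia.
by ring.
Qed.

(** * Convergence at negative [M], and the summation over [j] *)

(** Pairing the [k]-th numerator factors of the two q-binomials leaves [d] only in
    [q ^ d + q ^ (- d)], affinely, for every integer [M]. *)
Lemma burgeQ0_prod (i : nat) (M d : int) :
  burgeQ i%:Z M 0 d q = \prod_(k < i)
    ((1 + q ^ (2 * M + 2 * k%:Z + 2)) / (1 - q ^+ k.+1) ^+ 2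
      + - (q ^ (M + k%:Z + 1) / (1 - q ^+ k.+1) ^+ 2) * (q ^ d + q ^ (- d))).
Proof.
rewrite /burgeQ !addr0 !qbinom_nat.
have -> : i%:Z + M - d - i%:Z + 1 = M - d + 1 by ring.
have -> : i%:Z + M + d - i%:Z + 1 = M + d + 1 by ring.
elim: i => [|i IH]; first by rewrite big_ord0 !qpoch0 divr1 mulr1.
rewrite big_ord_recr /= -IH !qpochS -!exprS.
have -> : q ^ (2 * M + 2 * i%:Z + 2) = (q ^ M) ^+ 2 * (q ^+ i) ^+ 2 * q ^+ 2.
  rewrite !exprnP !exprz_exp -!expfzDr //; congr (_ ^ _); lia.
rewrite !expfzDr // !expr1z -exprnP.
have dd : q ^ d * q ^ (- d) = 1 by rewrite -expfzDr // subrr.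
have e : (1 - q ^ M * q ^ (- d) * q * q ^+ i) * (1 - q ^ M * q ^ d * q * q ^+ i) =
   1 + (q ^ M) ^+ 2 * (q ^+ i) ^+ 2 * q ^+ 2
   - (q ^ M * q ^+ i * q) * (q ^ d + q ^ (- d)).
  ring: dd.
have Q0 := subr_qX_neq0 (ltn0Sn i).
rewrite [LHS](_ : _ = qpoch (q ^ M * q ^ (- d) * q) q i / qpoch q q i
   * (qpoch (q ^ M * q ^ d * q) q i / qpoch q q i)
   * (((1 - q ^ M * q ^ (- d) * q * q ^+ i) * (1 - q ^ M * q ^ d * q * q ^+ i))
     / (1 - q ^+ i.+1) ^+ 2)); last by field; rewrite Q0 !qpoch_qq_neq0.
by rewrite e; field; rewrite Q0 !qpoch_qq_neq0.
Qed.

End QSeries.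

Lemma has_infsum_burge_term (K : topologicalFieldType) (q : K) (a b : nat)
    (A : nat -> K) :
  q != 0 -> (forall n : nat, (0 < n)%N -> q ^+ n != 1) ->
  (forall N : nat, has_infsum (burge_term a b q A N%:Z 0)) ->
  forall (i : nat) (M : int), has_infsum (burge_term a b q A i%:Z M).
Proof.
move=> hq0 hq hA i M; have [a0|a_gt0] := posnP a; last first.
  eexists; apply: (@sums_to_finite _ _ i.+1) => j ij.
  by rewrite /burge_term -PoszM burgeQ_lt ?mulr0 //; nia.
pose y (j : nat) := q ^ (b%:Z * j%:Z) + q ^ (- (b%:Z * j%:Z)).
pose r (M : int) (k : nat) := (1 + q ^ (2 * M + 2 * k%:Z + 2)) / (1 - q ^+ k.+1) ^+ 2.
pose s (M : int) (k : nat) := - (q ^ (M + k%:Z + 1) / (1 - q ^+ k.+1) ^+ 2).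
have bt k N : burge_term a b q A k%:Z N =
    fun j => A j * \prod_(l < k) (r N l + s N l * y j).
  by apply/funext => j; rewrite /burge_term a0 mul0r burgeQ0_prod.
(* The products at [M = 0], where convergence is given, serve as the family [p]. *)
rewrite bt; apply: (@has_infsum_affine_prod _ A y
  (fun k j => \prod_(l < k) (r 0 l + s 0 l * y j)) (r 0) (s 0)).
- move=> k; rewrite oppr_eq0 mulf_neq0 ?expfz_neq0 //.
  by rewrite invr_neq0 // expf_neq0 // subr_qX_neq0.
- by move=> j; rewrite big_ord0.
- by move=> k j; rewrite big_ord_recr.
- by move=> k; rewrite -bt.
Qed.

Theorem theorem2 (K : topologicalFieldType) (hK : hausdorff_space K)
  (q : K) (hq0 : q != 0) (hq : forall n : nat, (0 < n)%N -> q ^+ n != 1)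
  (a b : nat) (A : nat -> K) (B : nat -> int -> K)
  (hAB : burge_pair a b q A B)
  (hBneg : forall i M : nat,
    B i (-1 - M%:Z) = infsum (burge_term a b q A i%:Z (-1 - M%:Z))) :
  forall N M : nat,
    let lhs (i : nat) : K :=
      q ^ ((1 + 2 * M%:Z) * i%:Z)
      * qbinom q (2 * M%:Z + N%:Z - i%:Z) (N%:Z - i%:Z)
      * B i (-1 - M%:Z) in
    let rhs (j : nat) : K :=
      A j * q ^ (2 * a%:Z * j%:Z ^+ 2 * (a%:Z - b%:Z))
      * burgeQ N%:Z M%:Z (a%:Z * j%:Z) ((2 * a%:Z - b%:Z) * j%:Z) q in
    [/\ forall i : nat, has_infsum (burge_term a b q A i%:Z (-1 - M%:Z)),
        has_infsum lhs,
        has_infsum rhs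
      & infsum lhs = infsum rhs].
Proof.
move=> N M lhs rhs.
have conv i : has_infsum (burge_term a b q A i%:Z (-1 - M%:Z)).
  by apply: has_infsum_burge_term => // n; case: (hAB n 0%N).
(* For [i > N] the q-binomial has negative lower index, so only finitely many series over [j] have
   to be added. *)
have lhs_sum : sums_to lhs (\sum_(i < N.+1) lhs i).
  apply: sums_to_finite => i Ni.
  by rewrite /lhs qbinom_neg ?mulr0 ?mul0r // subr_lt0 ltz_nat.
have rhs_sum : sums_to rhs (\sum_(i < N.+1) lhs i).
  have := sums_to_sum (n := N.+1) (c := fun i => q ^ ((1 + 2 * M%:Z) * i%:Z)
      * qbinom q (2 * M%:Z + N%:Z - i%:Z) (N%:Z - i%:Z))
    (fun i => has_infsumP (conv i)).
  congr sums_to; last by apply: eq_bigr => i _; rewrite /lhs hBneg.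
  apply/funext => j; rewrite /rhs.
  have -> : 2 * a%:Z * j%:Z ^+ 2 * (a%:Z - b%:Z) =
    2 * (a * j)%N%:Z * ((a * j)%N%:Z - b%:Z * j%:Z) by rewrite PoszM; ring.
  have -> : (2 * a%:Z - b%:Z) * j%:Z = 2 * (a * j)%N%:Z - b%:Z * j%:Z.
    by rewrite PoszM; ring.
  rewrite -PoszM -mulrA -burge_sum // mulr_sumr; apply: eq_bigr => i _.
  by rewrite /burge_term -PoszM mulrCA.
split=> //; [by exists (\sum_(i < N.+1) lhs i)..|].
by rewrite (infsum_eq hK lhs_sum) (infsum_eq hK rhs_sum).
Qed.
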